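(* Let $D$ be a positive even integer, let $Q_D$ be the $D$-cube with vertex set $\mathcal X=\{0,1\}^D$, standard module $V=\mathbb C^{\mathcal X}$, adjacency matrix $\mathbf A$, and fix a base vertex $\mathbf x$. Let $T=T(\mathbf x)$ be the Terwilliger algebra and let $\mathbf B$ be the dual adjacency matrix of $Q_D$ with respect to $\mathbf x$ and the $Q$-polynomial ordering $\{(-1)^i(D-2i)\}_{i=0}^{D}$ of the eigenvalues (all defined in the context). Then: (i) There is a unique $\mathcal A$-module structure on $V$ such that the generators $x,y$ of $\mathcal A$ act as $\mathbf A,\mathbf B$ respectively. (ii) Let $W\subseteq V$ be an irreducible $T$-module with endpoint $r$. Then, with respect to the $\mathcal A$-module structure in (i), $W$ is an irreducible $\mathcal A$-module of type $B(D-2r)$.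
   Context: Hypercube: $Q_D$ has vertex set $\mathcal X=\{0,1\}^D$, two vertices being adjacent iff they differ in exactly one coordinate; $\partial$ is the path-length distance (the number of coordinates in which two vertices differ). $V=\mathbb C^{\mathcal X}$ is the space of column vectors indexed by $\mathcal X$, with basis vectors $\hat{\mathbf y}$ ($\mathbf y\in\mathcal X$); matrices in $\mathrm{Mat}_{\mathcal X}(\mathbb C)$ act on $V$ by left multiplication. $\mathbf A$ is the adjacency matrix; its eigenvalues are $D-2i$ ($0\le i\le D$). For an eigenvalue $\theta$ of $\mathbf A$, the primitive idempotent for $\theta$ is the orthogonal projection of $V$ onto the $\theta$-eigenspace (a polynomial in $\mathbf A$). For $0\le i\le D$, $\mathbf E_i^*$ is the diagonal matrix with $(\mathbf y,\mathbf y)$-entry $1$ if $\partial(\mathbf x,\mathbf y)=i$ and $0$ otherwise. The Terwilliger algebra $T$ is the subalgebra of $\mathrm{Mat}_{\mathcal X}(\mathbb C)$ generated by $\mathbf A$ and $\mathbf E_0^*,\dots,\mathbf E_D^*$. A $T$-module is a subspace $W\subseteq V$ with $\mathbf M W\subseteq W$ for all $\mathbf M\in T$; it is irreducible if $W\neq0$ and its only $T$-submodules are $0$ and $W$. The endpoint of an irreducible $T$-module $W$ is $\min\{i: \mathbf E_i^*W\ne 0\}$. The matrix $\mathbf B$ is the diagonal matrix whose $(\mathbf y,\mathbf y)$-entry is $|\mathcal X|(\mathbf F_1)_{\mathbf x\mathbf y}$, where $\mathbf F_1$ is the primitive idempotent of $\mathbf A$ for the eigenvalue $-(D-2)$; equivalently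 $\mathbf B$ is diagonal with $(\mathbf y,\mathbf y)$-entry $(-1)^{i}(D-2i)$ where $i=\partial(\mathbf x,\mathbf y)$. The anticommutator spin algebra $\mathcal A$ (over $\mathbb C$) is the unital associative algebra with generators $x,y,z$ and relations $xy+yx=2z$, $yz+zy=2x$, $zx+xz=2y$. For an even integer $d\ge0$, an $\mathcal A$-module has type $B(d)$ if it is isomorphic to the $\mathcal A$-module with basis $v_0,\dots,v_d$ on which, for $0\le i\le d$, $y.v_i=(d-i+1)v_{i-1}+(i+1)v_{i+1}$, $x.v_i=(-1)^i(d-2i)v_i$, $z.v_i=(-1)^{i-1}(d-i+1)v_{i-1}+(-1)^i(i+1)v_{i+1}$, where $v_{-1}=v_{d+1}=0$ (this module is irreducible). *)

(* Defs.v *)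
From HB Require Import structures.
From mathcomp Require Import all_boot all_order all_algebra.
From mathcomp Require Import boolp reals complex.

Set Implicit Arguments.
Unset Strict Implicit.
Unset Printing Implicit Defensive.

Import GRing.Theory Num.Theory.
Local Open Scope ring_scope.
Local Open Scope quotient_scope.

(* The anticommutator spin algebra over K: noncommutative expressions in the
   generators x, y, z and the scalars, modulo the least congruence containing
   the axioms of unital associative K-algebras and the defining relations. *)

Inductive spin_expr (K : Type) : Type :=
  | SpinX | SpinY | SpinZ
  | SpinC of K
  | SpinAdd of spin_expr K & spin_expr K
  | SpinMul of spin_expr K & spin_expr K.

Arguments SpinX {K}.
Arguments SpinY {K}.
Arguments SpinZ {K}.

HB.instance Definition _ (K : Type) := gen_eqMixin (spin_expr K).
HB.instance Definition _ (K : Type) := gen_choiceMixin (spin_expr K).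

Section SpinAlgebra.
Variable K : fieldType.

Local Notation expr := (spin_expr K).
Local Infix "+e" := (@SpinAdd K) (at level 50, left associativity).
Local Infix "*e" := (@SpinMul K) (at level 40, left associativity).
Local Notation "k %:e" := (SpinC k) (at level 2, format "k %:e").
Local Reserved Notation "a ~ b" (at level 70).

Inductive spin_cong : expr -> expr -> Prop :=
  | spin_refl a : a ~ a
  | spin_sym a b : a ~ b -> b ~ a
  | spin_trans a b c : a ~ b -> b ~ c -> a ~ c
  | spin_add a a' b b' : a ~ a' -> b ~ b' -> a +e b ~ a' +e b'
  | spin_mul a a' b b' : a ~ a' -> b ~ b' -> a *e b ~ a' *e b'
  | spin_addA a b c : a +e (b +e c) ~ a +e b +e c
  | spin_addC a b : a +e b ~ b +e a
  | spin_add0 a : 0%:e +e a ~ a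
  | spin_addN a : (-1)%:e *e a +e a ~ 0%:e
  | spin_mulA a b c : a *e (b *e c) ~ a *e b *e c
  | spin_mul1l a : 1%:e *e a ~ a
  | spin_mul1r a : a *e 1%:e ~ a
  | spin_mulDl a b c : (a +e b) *e c ~ a *e c +e b *e c
  | spin_mulDr a b c : a *e (b +e c) ~ a *e b +e a *e c
  | spin_scalarD k l : (k + l)%:e ~ k%:e +e l%:e
  | spin_scalarM k l : (k * l)%:e ~ k%:e *e l%:e
  | spin_central k a : k%:e *e a ~ a *e k%:e
  | spin_rel_xy : SpinX *e SpinY +e SpinY *e SpinX ~ 2%:e *e SpinZ
  | spin_rel_yz : SpinY *e SpinZ +e SpinZ *e SpinY ~ 2%:e *e SpinX
  | spin_rel_zx : SpinZ *e SpinX +e SpinX *e SpinZ ~ 2%:e *e SpinY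
where "a ~ b" := (spin_cong a b).

Definition spin_congb (a b : expr) : bool := `[< a ~ b >].

Lemma spin_congb_equiv : equiv_class_of spin_congb.
Proof.
split=> [a|a b|b a c]; first by apply/asboolP; exact: spin_refl.
- by apply/asboolP/asboolP; exact: spin_sym.
- by move=> /asboolP ab /asboolP bc; apply/asboolP; exact: spin_trans bc.
Qed.

Canonical spin_congb_rel := EquivRelPack spin_congb_equiv.

Definition spin_algebra := {eq_quot spin_congb_rel}.

HB.instance Definition _ := Choice.on spin_algebra.

Definition spin_pi (a : expr) : spin_algebra := \pi_spin_algebra a.

Lemma spin_piW (P : spin_algebra -> Prop) :
  (forall a, P (spin_pi a)) -> forall u, P u.
Proof. by move=> Ppi u; rewrite -[u]reprK; exact: Ppi. Qed.

Implicit Types u v w : spin_algebra.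

Lemma spin_eqP (a b : expr) : a ~ b -> spin_pi a = spin_pi b.
Proof. by move=> ab; apply/eqmodP/asboolP. Qed.

Lemma spin_reprP (a : expr) : repr (spin_pi a) ~ a.
Proof. by apply/asboolP; have /eqmodP := reprK (spin_pi a). Qed.

Definition spin_alg_add u v : spin_algebra := spin_pi (repr u +e repr v).
Definition spin_alg_mul u v : spin_algebra := spin_pi (repr u *e repr v).
Definition spin_alg_opp u : spin_algebra := spin_pi ((-1)%:e *e repr u).
Definition spin_alg_scale (k : K) u : spin_algebra := spin_pi (k%:e *e repr u).

Lemma spin_addE a b :
  spin_alg_add (spin_pi a) (spin_pi b) = spin_pi (a +e b).
Proof. by apply/spin_eqP/spin_add; exact: spin_reprP. Qed.

Lemma spin_mulE a b :
  spin_alg_mul (spin_pi a) (spin_pi b) = spin_pi (a *e b).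
Proof. by apply/spin_eqP/spin_mul; exact: spin_reprP. Qed.

Lemma spin_oppE a : spin_alg_opp (spin_pi a) = spin_pi ((-1)%:e *e a).
Proof. by apply/spin_eqP/spin_mul; [exact: spin_refl|exact: spin_reprP]. Qed.

Lemma spin_scaleE k a :
  spin_alg_scale k (spin_pi a) = spin_pi (k%:e *e a).
Proof. by apply/spin_eqP/spin_mul; [exact: spin_refl|exact: spin_reprP]. Qed.

Let spinE := (spin_addE, spin_mulE, spin_oppE, spin_scaleE).

Fact spin_alg_addA : associative spin_alg_add.
Proof.
by elim/spin_piW=> a; elim/spin_piW=> b; elim/spin_piW=> c; rewrite !spinE;
  apply/spin_eqP; exact: spin_addA.
Qed.

Fact spin_alg_addC : commutative spin_alg_add.
Proof.
by elim/spin_piW=> a; elim/spin_piW=> b; rewrite !spinE;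
  apply/spin_eqP; exact: spin_addC.
Qed.

Fact spin_alg_add0 : left_id (spin_pi 0%:e) spin_alg_add.
Proof. by elim/spin_piW=> a; rewrite !spinE;
  apply/spin_eqP; exact: spin_add0. Qed.

Fact spin_alg_addN :
  left_inverse (spin_pi 0%:e) spin_alg_opp spin_alg_add.
Proof. by elim/spin_piW=> a; rewrite !spinE;
  apply/spin_eqP; exact: spin_addN. Qed.

HB.instance Definition _ := GRing.isZmodule.Build spin_algebra
  spin_alg_addA spin_alg_addC spin_alg_add0 spin_alg_addN.

Fact spin_alg_mulA : associative spin_alg_mul.
Proof.
by elim/spin_piW=> a; elim/spin_piW=> b; elim/spin_piW=> c; rewrite !spinE;
  apply/spin_eqP; exact: spin_mulA.
Qed.

Fact spin_alg_mul1l : left_id (spin_pi 1%:e) spin_alg_mul.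
Proof. by elim/spin_piW=> a; rewrite !spinE;
  apply/spin_eqP; exact: spin_mul1l. Qed.

Fact spin_alg_mul1r : right_id (spin_pi 1%:e) spin_alg_mul.
Proof. by elim/spin_piW=> a; rewrite !spinE;
  apply/spin_eqP; exact: spin_mul1r. Qed.

Fact spin_alg_mulDl : left_distributive spin_alg_mul +%R.
Proof.
elim/spin_piW=> a; elim/spin_piW=> b; elim/spin_piW=> c.
by rewrite /GRing.add /= !spinE; apply/spin_eqP; exact: spin_mulDl.
Qed.

Fact spin_alg_mulDr : right_distributive spin_alg_mul +%R.
Proof.
elim/spin_piW=> a; elim/spin_piW=> b; elim/spin_piW=> c.
by rewrite /GRing.add /= !spinE; apply/spin_eqP; exact: spin_mulDr.
Qed.

(* The assignment x, y, z |-> 1 satisfies the relations: the algebra is not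
   the zero ring. *)
Fixpoint spin_eval1 (a : expr) : K :=
  match a with
  | SpinX | SpinY | SpinZ => 1
  | SpinC k => k
  | SpinAdd b c => spin_eval1 b + spin_eval1 c
  | SpinMul b c => spin_eval1 b * spin_eval1 c
  end.

Lemma spin_eval1_cong a b : a ~ b -> spin_eval1 a = spin_eval1 b.
Proof.
elim=> //=.
- by move=> c d e _ -> _ ->.
- by move=> c c' d d' _ -> _ ->.
- by move=> c c' d d' _ -> _ ->.
- by move=> *; rewrite addrA.
- by move=> *; rewrite addrC.
- by move=> *; rewrite add0r.
- by move=> *; rewrite mulN1r addNr.
- by move=> *; rewrite mulrA.
- by move=> *; rewrite mul1r.
- by move=> *; rewrite mulr1.
- by move=> *; rewrite mulrDl.
- by move=> *; rewrite mulrDr.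
- by move=> *; rewrite mulrC.
- by rewrite !mulr1.
- by rewrite !mulr1.
- by rewrite !mulr1.
Qed.

Fact spin_alg_neq0 : spin_pi 1%:e != 0.
Proof.
apply/eqP => /eqmodP /asboolP /spin_eval1_cong /= /eqP.
by rewrite oner_eq0.
Qed.

HB.instance Definition _ := GRing.Zmodule_isNzRing.Build spin_algebra
  spin_alg_mulA spin_alg_mul1l spin_alg_mul1r
  spin_alg_mulDl spin_alg_mulDr spin_alg_neq0.

Fact spin_alg_scaleA k l u :
  spin_alg_scale k (spin_alg_scale l u) = spin_alg_scale (k * l) u.
Proof.
elim/spin_piW: u => a; rewrite !spinE; apply/spin_eqP.
apply: spin_trans (spin_mulA _ _ _) _.
by apply: spin_mul (spin_refl _); exact/spin_sym/spin_scalarM.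
Qed.

Fact spin_alg_scale1 : left_id 1 spin_alg_scale.
Proof. by elim/spin_piW=> a; rewrite !spinE;
  apply/spin_eqP; exact: spin_mul1l. Qed.

Fact spin_alg_scaleDr : right_distributive spin_alg_scale +%R.
Proof.
move=> k; elim/spin_piW=> a; elim/spin_piW=> b.
by rewrite /GRing.add /= !spinE; apply/spin_eqP; exact: spin_mulDr.
Qed.

Fact spin_alg_scaleDl u : {morph spin_alg_scale^~ u : k l / k + l}.
Proof.
move=> k l; elim/spin_piW: u => a; rewrite [RHS]/GRing.add /= !spinE.
apply/spin_eqP; apply: spin_trans (spin_mulDl _ _ _).
by apply: spin_mul (spin_refl _); exact: spin_scalarD.
Qed.

HB.instance Definition _ := GRing.Zmodule_isLmodule.Build K spin_algebra
  spin_alg_scaleA spin_alg_scale1 spin_alg_scaleDr spin_alg_scaleDl.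

Fact spin_alg_scaleAl (k : K) u v : k *: (u * v) = (k *: u) * v.
Proof.
rewrite /GRing.scale /GRing.mul /=; elim/spin_piW: u => a.
elim/spin_piW: v => b.
by rewrite !spinE; apply/spin_eqP; exact: spin_mulA.
Qed.

HB.instance Definition _ :=
  GRing.Lmodule_isLalgebra.Build K spin_algebra spin_alg_scaleAl.

Fact spin_alg_scaleAr (k : K) u v : k *: (u * v) = u * (k *: v).
Proof.
rewrite /GRing.scale /GRing.mul /=; elim/spin_piW: u => a.
elim/spin_piW: v => b; rewrite !spinE; apply/spin_eqP.
apply: spin_trans (spin_mulA _ _ _) _.
apply: spin_trans (spin_sym (spin_mulA _ _ _)).
by apply: spin_mul (spin_refl _); exact: spin_central.
Qed.

HB.instance Definition _ :=
  GRing.Lalgebra_isAlgebra.Build K spin_algebra spin_alg_scaleAr.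

Definition spin_x : spin_algebra := spin_pi SpinX.
Definition spin_y : spin_algebra := spin_pi SpinY.
Definition spin_z : spin_algebra := spin_pi SpinZ.

Lemma spin_relations :
  [/\ spin_x * spin_y + spin_y * spin_x = 2 *: spin_z,
      spin_y * spin_z + spin_z * spin_y = 2 *: spin_x
    & spin_z * spin_x + spin_x * spin_z = 2 *: spin_y].
Proof.
rewrite /spin_x /spin_y /spin_z /GRing.scale /GRing.mul /GRing.add /=.
split; rewrite !spinE; apply/spin_eqP.
- exact: spin_rel_xy.
- exact: spin_rel_yz.
- exact: spin_rel_zx.
Qed.

End SpinAlgebra.

Arguments spin_x {K}.
Arguments spin_y {K}.
Arguments spin_z {K}.

Section SpinModules.
Variable K : fieldType.
Local Notation spin := (spin_algebra K).

Definition spin_module (V : lmodType K) (act : spin -> V -> V) : Prop :=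
  [/\ forall a, linear (act a),
      forall v, linear (act^~ v),
      forall v, act 1 v = v
    & forall a b v, act (a * b) v = act a (act b v)].

Definition stable (I : Type) (V : vectType K) (op : I -> V -> V)
    (W : {vspace V}) : Prop :=
  forall (a : I) (v : V), v \in W -> op a v \in W.

Definition irreducible (I : Type) (V : vectType K) (op : I -> V -> V)
    (W : {vspace V}) : Prop :=
  [/\ stable op W, W != 0%VS
    & forall U : {vspace V}, stable op U -> (U <= W)%VS ->
        U = 0%VS \/ U = W].

(* The standard basis v_0, ..., v_d of K^(d+1), extended by v_i = 0 for every
   other integer i. *)
Definition vB (d : nat) (i : int) : 'cV[K]_d.+1 :=
  \col_(j < d.+1) (j%:Z == i)%:R.

Definition typeB_model (d : nat)
    (act : spin -> 'cV[K]_d.+1 -> 'cV[K]_d.+1) : Prop :=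
  spin_module act /\
  forall i : nat, (i <= d)%N ->
  [/\ act spin_y (vB d i) =
        (d - i + 1)%N%:R *: vB d (i%:Z - 1) + (i + 1)%N%:R *: vB d (i%:Z + 1),
      act spin_x (vB d i) = ((-1) ^+ i * (d%:R - (2 * i)%N%:R)) *: vB d i
    & act spin_z (vB d i) =
        ((-1) ^ (i%:Z - 1) * (d - i + 1)%N%:R) *: vB d (i%:Z - 1)
        + ((-1) ^+ i * (i + 1)%N%:R) *: vB d (i%:Z + 1)].

(* The submodule W of V is isomorphic to the model module, for d even. *)
Definition typeB (V : vectType K) (act : spin -> V -> V) (W : {vspace V})
    (d : nat) : Prop :=
  ~~ odd d /\
  exists actB : spin -> 'cV[K]_d.+1 -> 'cV[K]_d.+1, typeB_model actB /\
  exists phi : 'Hom('cV[K]_d.+1, V),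
    [/\ lker phi = 0%VS, limg phi = W
      & forall a u, phi (actB a u) = act a (phi u)].

End SpinModules.

Notation cube D := {ffun 'I_D -> bool}.

Definition cube_dist (D : nat) (y z : cube D) : nat := #|[set i | y i != z i]|.

(* Column vectors indexed by the vertices: vertex y has index enum_rank y, and
   index j stands for the vertex enum_val j. Same for matrices below. *)
Notation std_module C D := 'cV[C]_#|cube D|.

Section Hypercube.
Variables (C : numClosedFieldType) (D : nat).

Local Notation N := #|cube D|.
Local Notation V := (std_module C D).

Definition cube_adj : 'M[C]_N :=
  \matrix_(i, j) (cube_dist (enum_val i) (enum_val j) == 1%N)%:R.

(* spectral.v projects row vectors acting on the left; the transpositions turn
   this into the projection of column vectors onto {v | M *m v = a *: v}. *)
Definition primitive_idempotent (n : nat) (M : 'M[C]_n) (a : C) : 'M[C]_n :=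
  (proj_ortho (eigenspace M^T a))^T.

Definition cube_theta (i : nat) : C := (-1) ^+ i * (D%:R - (2 * i)%N%:R).

Variable x : cube D.

Definition dual_idempotent (i : nat) : 'M[C]_N :=
  diag_mx (\row_j (cube_dist x (enum_val j) == i)%:R).

Definition dual_adj : 'M[C]_N :=
  diag_mx (\row_j
    (N%:R * primitive_idempotent cube_adj (cube_theta 1) (enum_rank x) j)).

Inductive terwilliger : 'M[C]_N -> Prop :=
  | terwilliger_adj : terwilliger cube_adj
  | terwilliger_dual i : (i <= D)%N -> terwilliger (dual_idempotent i)
  | terwilliger_scalar a : terwilliger a%:M
  | terwilliger_add M M' :
      terwilliger M -> terwilliger M' -> terwilliger (M + M')
  | terwilliger_mul M M' :
      terwilliger M -> terwilliger M' -> terwilliger (M *m M').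

Definition terwilliger_act (M : {M : 'M[C]_N | terwilliger M})
    (v : V) : V := sval M *m v.

Definition endpoint (W : {vspace V}) (r : nat) : Prop :=
  let EW i : {vspace V} :=
    (linfun (mulmx (dual_idempotent i) : V -> V) @: W)%VS in
  [/\ (r <= D)%N, EW r != 0%VS & forall i, (i < r)%N -> EW i = 0%VS].

Definition cube_spin_module
    (act : spin_algebra C -> V -> V) : Prop :=
  [/\ spin_module act,
      forall v, act spin_x v = cube_adj *m v
    & forall v, act spin_y v = dual_adj *m v].

End Hypercube.

(* Main.v *)
(* With a_i(y) = (-1)^(x_i + y_i), the matrix B is diagonal with entries
   (prod_i a_i) (sum_i a_i), as one sees by expanding the primitive idempotent
   in the characters of the cube.  Flipping coordinate i changes the sign of
   a_i only, and the relations of the anticommutator spin algebra, for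
   z = (AB + BA)/2, become sums over paths of length at most 2.

   In a module, if x u = delta u and y u = z u, then the vectors
   u_(i+1) = (y + (-1)^i z) u_i / (2 (i+1)) are eigenvectors of x with the
   eigenvalues (-1)^i (delta - 2i), on which y and z act as in B(delta).  For
   delta an even integer these eigenvalues are distinct, so in finite dimension
   the chain stops, and it can only stop at i = delta.

   Let w be a nonzero vector of E*_r W.  The relations are invariant under
   (x, y, z) -> (e y, x, e z) with e^2 = 1; with e = (-1)^r, the vector w starts
   a chain for (e B, A, e Z) with delta = D - 2r, since A maps w to layer r+1.
   Its span is stable under A and B, hence under T because D is even, so it is
   W.  The sum of this chain is an eigenvector of A for D - 2r and starts a
   second chain, now for (A, B, Z); its span is again W, and it is the basis of
   type B(D - 2r). *)

Require Import Defs.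
From mathcomp Require Import all_boot all_order all_algebra.
From mathcomp Require Import boolp reals complex.
From mathcomp Require Import spectral zify ring.

Set Implicit Arguments.
Unset Strict Implicit.
Unset Printing Implicit Defensive.

Import Order.TTheory GRing.Theory Num.Theory.
Local Open Scope ring_scope.

(** * Chains of eigenvectors of a spin triple *)

(** Induction on [n]: apply [f - lambda n] to an expansion of [u n] in the earlier vectors. Each
    coefficient gets multiplied by the nonzero [lambda i - lambda n], so freeness of the earlier
    vectors makes it vanish. *)
Lemma eigenvectors_free (K : fieldType) (V : vectType K) (f : {linear V -> V})
    (lambda : nat -> K) (u : nat -> V) (n : nat) :
  injective lambda -> (forall i, f (u i) = lambda i *: u i) ->
  (forall i, (i < n)%N -> u i != 0) -> free (mkseq u n).
Proof.
move=> inj_lambda fu; elim: n => [|n IHn] u_neq0; first by rewrite nil_free.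
have {IHn} free_n : free (mkseq u n) by apply: IHn => i /ltnW; apply: u_neq0.
have size_n : size (mkseq u n) == n by rewrite size_mkseq.
rewrite mkseqS -cats1 (perm_free (permEl (perm_catC _ _))) free_cons free_n andbT.
apply/negP => u_span.
have /= u_n := coord_span (X := Tuple size_n) u_span.
set c := coord (Tuple size_n) in u_n.
have nthu (i : 'I_n) : (mkseq u n)`_i = u i by rewrite nth_mkseq.
have : \sum_(i < n) (c i (u n) * (lambda i - lambda n)) *: (mkseq u n)`_i = 0.
  transitivity (f (u n) - lambda n *: u n); last by rewrite fu subrr.
  rewrite {2 3}u_n linear_sum scaler_sumr -sumrB; apply: eq_bigr => i _.
  by rewrite nthu linearZZ fu !scalerA -scalerBl mulrBr [lambda n * _]mulrC.
move/(freeP (X := Tuple size_n)): free_n => free_n /free_n c_eq0.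
have /eqP[] := u_neq0 n (leqnn _); rewrite u_n big1 // => i _.
have /eqP := c_eq0 i; rewrite mulf_eq0 subr_eq0 => /orP[/eqP ->|/eqP].
  by rewrite scale0r.
by move/inj_lambda=> eq_in; have := ltn_ord i; rewrite eq_in ltnn.
Qed.

Lemma eigenvectors_eq0 (K : fieldType) (V : vectType K) (f : {linear V -> V})
    (lambda : nat -> K) (u : nat -> V) :
  injective lambda -> (forall i, f (u i) = lambda i *: u i) ->
  exists i, u i = 0.
Proof.
move=> inj_lambda fu; pose n := (\dim {:V}).+1.
have [all_neq0|] := boolP [forall i : 'I_n, u i != 0]; last first.
  by case/forallPn=> i; rewrite negbK => /eqP; exists i.
have /eqP : free (mkseq u n).
  apply: eigenvectors_free inj_lambda fu _ => i lt_in.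
  exact: (forallP all_neq0 (Ordinal lt_in)).
rewrite size_mkseq => dim_n.
by have := dimvS (subvf <<mkseq u n>>); rewrite dim_n ltnn.
Qed.

Lemma span_mkseq_subv (K : fieldType) (V : vectType K) (u : nat -> V) (n : nat)
    (U : {vspace V}) :
  (forall i, (i < n)%N -> u i \in U) -> (<<mkseq u n>> <= U)%VS.
Proof.
move=> uU; apply/span_subvP => w /mapP[k]; rewrite mem_iota => lt_kn ->.
exact: uU.
Qed.

(** For indices of opposite parity, equality would force the odd number [i + j] to be [2 k]. *)
Lemma spin_eigenvalue_inj (K : numDomainType) (k : int) :
  injective (fun i : nat => (-1) ^+ i * ((2 * k)%:~R - (2 * i)%N%:R) : K).
Proof.
move=> i j.
have cast n : (-1) ^+ n * ((2 * k)%:~R - (2 * n)%N%:R) =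
    (((-1) ^+ odd n * (2 * k - (2 * n)%:Z))%:~R : K).
  by rewrite -[in LHS]signr_odd [RHS]intrM intrB rmorph_sign.
rewrite !cast => /eqP; rewrite eqr_int => /eqP.
by case: (boolP (odd i)) (boolP (odd j)) => [] oi [] oj; rewrite /= ?expr1 ?expr0; lia.
Qed.

Section SpinChain.
Variables (K : numFieldType) (n : nat) (X Y Z : 'M[K]_n).

Definition spin_triple : Prop :=
  [/\ X *m Y + Y *m X = 2 *: Z, Y *m Z + Z *m Y = 2 *: X
    & Z *m X + X *m Z = 2 *: Y].

Definition spin_shift (e : K) : 'M[K]_n := Y + e *: Z.

Variable u : 'cV[K]_n.

(** The factor [2 (j+1)] is chosen so that [Y] and [Z] act with the coefficients of the basis of
    [B(delta)]. *)
Fixpoint spin_chain (i : nat) : 'cV[K]_n :=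
  if i is j.+1
  then (2 * j.+1%:R)^-1 *: (spin_shift ((-1) ^+ j) *m spin_chain j)
  else u.

Local Notation v := spin_chain.

Lemma spin_chain_up i :
  spin_shift ((-1) ^+ i) *m v i = (2 * i.+1%:R) *: v i.+1.
Proof. by rewrite /= scalerA mulfV ?scale1r // mulf_neq0 ?pnatr_eq0. Qed.

Hypothesis XYZ : spin_triple.

(** For [S = Y + e Z] the first and third relations give [X S + S X = 2 Z + 2 e Y = 2 e S], because
    [e^2 = 1]. *)
Lemma spin_shift_eigen (e lambda : K) (w : 'cV[K]_n) :
  e * e = 1 -> X *m w = lambda *: w ->
  X *m (spin_shift e *m w) = (2 * e - lambda) *: (spin_shift e *m w).
Proof.
case: XYZ => rXY _ rZX ee Xw; rewrite /spin_shift.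
have XYw : X *m (Y *m w) = 2 *: (Z *m w) - lambda *: (Y *m w).
  by rewrite !mulmxA -(addrK (Y *m X) (X *m Y)) rXY mulmxBl -mulmxA Xw
    -scalemxAl -scalemxAr.
have XZw : X *m (Z *m w) = 2 *: (Y *m w) - lambda *: (Z *m w).
  by rewrite !mulmxA -(addKr (Z *m X) (X *m Z)) rZX addrC mulmxBl -mulmxA Xw
    -scalemxAl -scalemxAr.
rewrite mulmxDl -scalemxAl mulmxDr -scalemxAr XYw XZw.
move: (Y *m w) (Z *m w) => a b; apply/matrixP => i j; rewrite !mxE.
by ring: ee.
Qed.

(** The squares differ by [2 e (Y Z + Z Y)], which is [4 e X] by the second relation. This makes a
    step back down the chain computable. *)
Lemma spin_shift_sqr (e : K) :
  spin_shift e *m spin_shift e =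
  spin_shift (- e) *m spin_shift (- e) + (4 * e) *: X.
Proof.
case: XYZ => _ rYZ _; rewrite /spin_shift.
have -> : (4 * e) *: X = (2 * e) *: (Y *m Z + Z *m Y).
  by rewrite rYZ scalerA; congr (_ *: _); ring.
rewrite !mulmxDl !mulmxDr -!scalemxAl -!scalemxAr.
move: (Y *m Y) (Y *m Z) (Z *m Y) (Z *m Z) => a b c d.
by apply/matrixP => i j; rewrite !mxE; ring.
Qed.

Variable delta : K.
Hypothesis Xu : X *m u = delta *: u.
Hypothesis YZu : Y *m u = Z *m u.

Lemma spin_chainX i :
  X *m v i = ((-1) ^+ i * (delta - (2 * i)%N%:R)) *: v i.
Proof.
elim: i => [|i IHi]; first by rewrite /= Xu expr0 mul1r subr0.
have ee : (-1) ^+ i * (-1) ^+ i = 1 :> K by rewrite -expr2 sqrr_sign.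
rewrite /= -scalemxAr (spin_shift_eigen ee IHi) !scalerA mulrC.
congr (_ * _ *: _); rewrite mulnS natrD exprS; ring.
Qed.

(** Write [S_e] for the shift and [e = (-1)^i]. The square formula reduces [S_e S_e v_i] to
    [S_(-e) S_(-e) v_i] plus a multiple of [v_i]. By induction [S_(-e)] takes [v_i] down to
    [v_(i-1)] and then up again, and [i (delta - i + 1) + delta - 2i = (i + 1)(delta - i)]. *)
Lemma spin_chain_down i :
  spin_shift ((-1) ^+ i) *m v i.+1 = (2 * (delta - i%:R)) *: v i.
Proof.
have nz j : 2 * j.+1%:R != 0 :> K by rewrite mulf_neq0 ?pnatr_eq0.
have step j w : spin_shift (- (-1) ^+ j) *m v j = w ->
    (2 * j.+1%:R) *: (spin_shift ((-1) ^+ j) *m v j.+1) =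
    spin_shift (- (-1) ^+ j) *m w + (4 * (delta - (2 * j)%N%:R)) *: v j.
  move=> <-; rewrite scalemxAr -spin_chain_up !mulmxA (spin_shift_sqr (_ ^+ _)).
  rewrite mulmxDl -scalemxAl spin_chainX scalerA.
  congr (_ + _ *: _); have /esym := sqrr_sign K j.
  move: ((-1) ^+ j) (delta - _) => e d; rewrite expr2 => /esym ee.
  by ring: ee.
elim: i => [|i IHi].
  (* Nothing lies below [u]: [S_(-1) u = Y u - Z u = 0]. *)
  apply: (scalerI (nz 0)); rewrite (step 0 0); last first.
    by rewrite /spin_shift expr0 mulmxDl YZu scaleN1r mulNmx subrr.
  rewrite mulmx0 add0r scalerA; congr (_ *: _); rewrite muln0; ring.
apply: (scalerI (nz i.+1)).
rewrite (step _ ((2 * (delta - i%:R)) *: v i)); last first.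
  by rewrite exprS mulN1r opprK IHi.
rewrite exprS mulN1r opprK -scalemxAr spin_chain_up !scalerA -scalerDl.
by congr (_ *: _); rewrite natrM -!natr1; ring.
Qed.

Lemma spin_chainY0 : Y *m v 0 = v 1.
Proof.
apply: (@scalerI _ _ 2); first by rewrite pnatr_eq0.
rewrite -[2 in RHS]mulr1 -(spin_chain_up 0) /spin_shift expr0 scale1r mulmxDl.
by rewrite -YZu -mulr2n scaler_nat.
Qed.

Lemma spin_chainZ0 : Z *m v 0 = v 1.
Proof. by rewrite -spin_chainY0 YZu. Qed.

(** [2 Y = S_e + S_(-e)], and for [e = (-1)^i] these two shifts send [v_(i+1)] down and up.
    [2 e Z = S_e - S_(-e)] handles [Z] in the same way. *)
Lemma spin_chainYS i :
  Y *m v i.+1 = (delta - i%:R) *: v i + i.+2%:R *: v i.+2.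
Proof.
have /matrixP dn := spin_chain_down i; have /matrixP up := spin_chain_up i.+1.
apply/matrixP => j k; have := dn j k; have := up j k; clear.
rewrite exprS /spin_shift !mulmxDl -!scalemxAl.
move: (v i) (v i.+2) (Y *m _) (Z *m _) => a b c d; rewrite !mxE => up dn.
apply: (@mulfI _ 2); first by rewrite pnatr_eq0.
transitivity ((c j k + -1 * (-1) ^+ i * d j k) + (c j k + (-1) ^+ i * d j k)).
  by ring.
by rewrite up dn; ring.
Qed.

Lemma spin_chainZS i :
  Z *m v i.+1 =
  ((-1) ^+ i * (delta - i%:R)) *: v i + ((-1) ^+ i.+1 * i.+2%:R) *: v i.+2.
Proof.
have /matrixP dn := spin_chain_down i; have /matrixP up := spin_chain_up i.+1.
have ee : (-1) ^+ i * (-1) ^+ i = 1 :> K by rewrite -expr2 sqrr_sign.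
apply/matrixP => j k; have := dn j k; have := up j k; move: ee; clear.
rewrite exprS /spin_shift !mulmxDl -!scalemxAl.
move: (v i) (v i.+2) (Y *m _) (Z *m _) ((-1) ^+ i) => a b c d e.
rewrite !mxE => ee up dn.
apply: (@mulfI _ (2 * e)).
  rewrite mulf_neq0 ?pnatr_eq0 //; apply: contra_eq_neq ee => ->.
  by rewrite mul0r eq_sym oner_neq0.
transitivity ((c j k + e * d j k) - (c j k + -1 * e * d j k)); first by ring.
by rewrite up dn; ring: ee.
Qed.

(** At the first zero [v_(m+1)], stepping down gives [2 (delta - m) v_m = 0] with [v_m != 0]. That
    [delta] is nonnegative is thus a conclusion. *)
Lemma spin_chain_end (k : int) : delta = (2 * k)%:~R -> u != 0 ->
  exists m : nat, [/\ delta = m%:R, free (mkseq v m.+1) & v m.+1 = 0].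
Proof.
move=> def_delta u_neq0.
have inj_eigen := @spin_eigenvalue_inj K k; rewrite -def_delta in inj_eigen.
have eigen i : mulmx X (v i) = ((-1) ^+ i * (delta - (2 * i)%N%:R)) *: v i.
  exact: spin_chainX.
have [i0 /eqP v_i0] := eigenvectors_eq0 inj_eigen eigen.
have ex0 : exists i, v i == 0 by exists i0.
case: (ex_minnP ex0) => [] [|m] /eqP vm_eq0 min_m.
  by rewrite -vm_eq0 eqxx in u_neq0.
have v_neq0 i : (i < m.+1)%N -> v i != 0.
  by move=> lt_im; apply: contraL lt_im => /min_m; rewrite -leqNgt.
exists m; split=> //; last exact: eigenvectors_free inj_eigen eigen v_neq0.
have := spin_chain_down m; rewrite vm_eq0 mulmx0 => /esym/eqP.
rewrite scaler_eq0 (negPf (v_neq0 _ _)) // orbF mulf_eq0 pnatr_eq0 /=.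
by rewrite subr_eq0 => /eqP.
Qed.

(** The coefficient of [v_i] is [delta - i] from [Y v_(i+1)] plus [i] from [Y v_(i-1)]. The boundary
    terms vanish once [delta = m] and [v_(m+1) = 0], so the sum of a full chain is an eigenvector of
    [Y]. *)
Lemma spin_chain_sumY m :
  \sum_(i < m.+1) Y *m v i =
  delta *: (\sum_(i < m.+1) v i) + m.+1%:R *: v m.+1 - (delta - m%:R) *: v m.
Proof.
elim: m => [|m IHm].
  rewrite !big_ord1 spin_chainY0 subr0 scale1r.
  by rewrite [_ *: v 0 + _]addrC addrK.
rewrite big_ord_recr IHm spin_chainYS [\sum_(i < m.+2) _]big_ord_recr /=.
move: (\sum_(i < _) _) (v m) (v m.+1) (v m.+2) => s a b c; clear.
by apply/matrixP=> j k; rewrite !mxE -[m.+2%:R]natr1 -natr1; ring.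
Qed.

(** Here the contributions to [v_i] add up to [(-1)^i (delta - 2i)], its eigenvalue under [X]. On
    the sum of a full chain [X] and [Z] therefore agree, as a chain with [X] and [Y] exchanged needs
    of its first vector. *)
Lemma spin_chain_sumZ m :
  \sum_(i < m.+1) Z *m v i =
  \sum_(i < m.+1) X *m v i
  + (-1) ^+ m *: (m.+1%:R *: v m.+1 - (delta - m%:R) *: v m).
Proof.
elim: m => [|m IHm].
  rewrite !big_ord1 spin_chainZ0 spin_chainX expr0 !scale1r mul1r muln0 subr0.
  by rewrite addrC subrK.
rewrite !(big_ord_recr m.+1) IHm spin_chainZS spin_chainX /= exprS.
move: (\sum_(i < _) _) (v m) (v m.+1) (v m.+2) => s a b c; clear.
apply/matrixP=> j k; rewrite !mxE natrM -[m.+2%:R]natr1 -natr1.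
by move: ((-1) ^+ m) => e; ring.
Qed.

Lemma mem_spin_chain (W : {vspace 'cV[K]_n}) i :
  (forall w, w \in W -> Y *m w \in W) -> (forall w, w \in W -> Z *m w \in W) ->
  u \in W -> v i \in W.
Proof.
move=> WY WZ Wu; elim: i => //= i Wi.
by rewrite memvZ // mulmxDl -scalemxAl memvD ?memvZ ?WY ?WZ.
Qed.

Lemma mem_spin_chain_span m i : (i < m)%N -> v i \in <<mkseq v m>>%VS.
Proof. by move=> lt_im; apply/memv_span/map_f; rewrite mem_iota. Qed.

Lemma spin_chain_span_stable m (W := <<mkseq v m.+1>>%VS) : v m.+1 = 0 ->
  (forall w, w \in W -> X *m w \in W) /\ (forall w, w \in W -> Y *m w \in W).
Proof.
move=> vS_eq0.
have span_stable (M : 'M[K]_n) : (forall i, (i <= m)%N -> M *m v i \in W) ->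
    forall w, w \in W -> M *m w \in W.
  move=> Mv w w_span; have size_v : size (mkseq v m.+1) == m.+1.
    by rewrite size_mkseq.
  rewrite (coord_span (X := Tuple size_v) w_span) mulmx_sumr memv_suml // => i _.
  by rewrite -scalemxAr memvZ //= nth_mkseq // Mv // -ltnS.
(* The vanishing of [v_(m+1)] keeps [Y v_m] in the span. *)
have memS i : (i <= m.+1)%N -> v i \in W.
  rewrite leq_eqVlt => /orP[/eqP ->|]; last exact: mem_spin_chain_span.
  by rewrite vS_eq0 mem0v.
split; apply: span_stable => i le_im.
  by rewrite spin_chainX memvZ // memS // ltnW.
case: i le_im => [|i] le_im; first by rewrite spin_chainY0 memS.
by rewrite spin_chainYS memvD // memvZ // memS // ltnW // ltnW.
Qed.

Lemma spin_chain_sum_neq0 m :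
  free (mkseq v m.+1) -> \sum_(i < m.+1) v i != 0.
Proof.
have size_v : size (mkseq v m.+1) == m.+1 by rewrite size_mkseq.
move=> /(freeP (X := Tuple size_v))/(_ (fun=> 1)) free_v; apply/eqP => sum_eq0.
have sum0 : \sum_(j < m.+1) 1 *: (mkseq v m.+1)`_j = 0.
  by rewrite -[RHS]sum_eq0; apply: eq_bigr => k _; rewrite scale1r nth_mkseq.
by have /eqP := free_v sum0 ord0; rewrite oner_eq0.
Qed.

End SpinChain.

Lemma spin_triple_twist (K : numFieldType) (n : nat) (X Y Z : 'M[K]_n) (e : K) :
  e * e = 1 -> spin_triple X Y Z -> spin_triple (e *: Y) X (e *: Z).
Proof.
move=> ee [rXY rYZ rZX]; split; rewrite -?scalemxAl -?scalemxAr -?scalerDr.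
- by rewrite addrC rXY scalerA mulrC -scalerA.
- by rewrite addrC rZX scalerA mulrC -scalerA.
- by rewrite !scalerA ee !scale1r addrC rYZ.
Qed.

(** * Modules over the anticommutator spin algebra *)

Section SpinMatrixModule.
Variables (K : numFieldType) (n : nat) (X Y Z : 'M[K]_n).
Hypothesis XYZ : spin_triple X Y Z.

(** Evaluation at [X], [Y], [Z]; it respects [spin_cong] and so descends to the quotient algebra. *)
Fixpoint spin_mx (a : spin_expr K) : 'M[K]_n :=
  match a with
  | SpinX => X
  | SpinY => Y
  | SpinZ => Z
  | SpinC k => k%:M
  | SpinAdd b c => spin_mx b + spin_mx c
  | SpinMul b c => spin_mx b *m spin_mx c
  end.

Lemma spin_mx_cong a b : spin_cong a b -> spin_mx a = spin_mx b.
Proof.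
case: XYZ => rXY rYZ rZX; elim=> //=.
- by move=> c d e _ -> _ ->.
- by move=> c c' d d' _ -> _ ->.
- by move=> c c' d d' _ -> _ ->.
- by move=> *; rewrite addrA.
- by move=> *; rewrite addrC.
- by move=> *; rewrite raddf0 add0r.
- by move=> c; rewrite mul_scalar_mx scaleN1r addNr raddf0.
- by move=> *; rewrite mulmxA.
- by move=> *; rewrite mul1mx.
- by move=> *; rewrite mulmx1.
- by move=> *; rewrite mulmxDl.
- by move=> *; rewrite mulmxDr.
- by move=> *; rewrite raddfD.
- by move=> *; rewrite scalar_mxM.
- by move=> *; rewrite scalar_mxC.
- by rewrite mul_scalar_mx.
- by rewrite mul_scalar_mx.
- by rewrite mul_scalar_mx.
Qed.

Definition spin_mx_act (a : spin_algebra K) (v : 'cV[K]_n) : 'cV[K]_n :=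
  spin_mx (repr a) *m v.

Lemma spin_mx_act_pi (a : spin_expr K) v : spin_mx_act (spin_pi a) v = spin_mx a *m v.
Proof. by rewrite /spin_mx_act (spin_mx_cong (spin_reprP a)). Qed.

Lemma spin_mx_act_module : spin_module spin_mx_act.
Proof.
split.
- by move=> a k u v; rewrite /spin_mx_act mulmxDr scalemxAr.
- move=> v k a b; elim/spin_piW: a => a; elim/spin_piW: b => b.
  rewrite [k *: _]/GRing.scale /= spin_scaleE [_ + _]/GRing.add /= spin_addE.
  by rewrite !spin_mx_act_pi /= mul_scalar_mx mulmxDl scalemxAl.
- by move=> v; rewrite [1]/GRing.one /= spin_mx_act_pi mul1mx.
- move=> a b v; elim/spin_piW: a => a; elim/spin_piW: b => b.
  by rewrite -[spin_pi a * _]/(spin_alg_mul _ _) spin_mulE !spin_mx_act_pi /= mulmxA.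
Qed.

Variable act : spin_algebra K -> 'cV[K]_n -> 'cV[K]_n.
Hypothesis act_module : spin_module act.
Hypothesis act_x : forall v, act spin_x v = X *m v.
Hypothesis act_y : forall v, act spin_y v = Y *m v.

(** [2 z = x y + y x] and [2] is invertible, so [x] and [y] determine the action of [z]. *)
Lemma spin_act_z v : act spin_z v = Z *m v.
Proof.
case: act_module => linr linl act1 actM; case: XYZ => rXY _ _.
have act2 k a w : act (k *: a) w = k *: act a w.
  (* The instance at [-1], [0], [0] yields [act 0 w = 0]. *)
  have := linl w k a 0; have := linl w (-1) 0 0.
  by rewrite scaler0 addr0 scaleN1r addNr addr0 => ->; rewrite addr0.
have actD a b w : act (a + b) w = act a w + act b w.
  by have := linl w 1 a b; rewrite !scale1r.
apply: (@scalerI _ _ 2); first by rewrite pnatr_eq0.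
rewrite -act2; case: (spin_relations K) => <- _ _.
by rewrite actD !actM !act_x !act_y !mulmxA -mulmxDl rXY -scalemxAl.
Qed.

Lemma spin_act_mxE a v : act (spin_pi a) v = spin_mx a *m v.
Proof.
case: act_module => linr linl act1 actM.
elim: a v => /= [||| k | a IHa b IHb | a IHa b IHb] v.
- exact: act_x.
- exact: act_y.
- exact: spin_act_z.
- have -> : spin_pi (SpinC k) = k *: 1 + 0.
    rewrite addr0 [RHS]/GRing.scale /= [1]/GRing.one /= spin_scaleE.
    exact/esym/spin_eqP/spin_mul1r.
  have := linl v (-1) 0 0; rewrite scaler0 addr0 scaleN1r addNr => act0.
  by have /= -> := linl v k 1 0; rewrite act0 addr0 act1 mul_scalar_mx.
- have -> : spin_pi (SpinAdd a b) = 1 *: spin_pi a + spin_pi b.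
    by rewrite scale1r [RHS]/GRing.add /= spin_addE.
  by have /= -> := linl v 1 (spin_pi a) (spin_pi b); rewrite scale1r IHa IHb mulmxDl.
- have -> : spin_pi (SpinMul a b) = spin_pi a * spin_pi b.
    by rewrite [RHS]/GRing.mul /= spin_mulE.
  by rewrite actM IHb IHa mulmxA.
Qed.

Lemma spin_act_stable (W : {vspace 'cV[K]_n}) :
  (forall v, v \in W -> X *m v \in W) -> (forall v, v \in W -> Y *m v \in W) ->
  stable act W.
Proof.
move=> WX WY a; elim/spin_piW: a => a v; rewrite spin_act_mxE.
elim: a v => /= [||| k | a IHa b IHb | a IHa b IHb] v Wv.
- exact: WX.
- exact: WY.
- rewrite -[Z]scale1r -[1](@mulVf _ 2) ?pnatr_eq0 // -scalerA.
  case: XYZ => <- _ _; rewrite -scalemxAl memvZ // mulmxDl -!mulmxA.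
  by rewrite memvD ?WX ?WY // ?WX ?WY.
- by rewrite mul_scalar_mx memvZ.
- by rewrite mulmxDl memvD ?IHa ?IHb.
- by rewrite -mulmxA IHa ?IHb.
Qed.

(** * The chain as a basis of type B *)

Section TypeB.
Variables (u : 'cV[K]_n) (m : nat).
Local Notation v := (spin_chain Y Z u).
Hypotheses (Xu : X *m u = m%:R *: u) (YZu : Y *m u = Z *m u).
Hypotheses (free_v : free (mkseq v m.+1)) (vS_eq0 : v m.+1 = 0).
Hypothesis m_even : ~~ odd m.

Lemma spin_chain_typeB : typeB act <<mkseq v m.+1>>%VS m.
Proof.
split=> //; set W := <<_>>%VS; have W_stable : stable act W.
  by case: (spin_chain_span_stable XYZ Xu YZu vS_eq0); apply: spin_act_stable.
case: act_module => linr linl act1 actM.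
(* The columns of [M] are the chain, so [phi] sends the standard basis to it. *)
pose M := \matrix_(i < n, j < m.+1) v j i 0.
pose phi : 'Hom('cV[K]_m.+1, 'cV[K]_n) := linfun (mulmx M).
have phiE c : phi c = \sum_j c j 0 *: v j.
  rewrite lfunE /=; apply/matrixP => i k; rewrite !mxE summxE (ord1 k).
  by apply: eq_bigr => j _; rewrite !mxE mulrC.
have size_v : size (mkseq v m.+1) == m.+1 by rewrite size_mkseq.
have nthv (i : 'I_m.+1) : (mkseq v m.+1)`_i = v i by rewrite nth_mkseq.
have phi_delta (j : 'I_m.+1) : phi (delta_mx j 0) = v j.
  rewrite phiE (bigD1 j) //= mxE !eqxx scale1r big1 ?addr0 // => k neq_kj.
  by rewrite mxE (negPf neq_kj) scale0r.
have ker_phi : lker phi = 0%VS.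
  apply/eqP; rewrite -subv0; apply/subvP => c; rewrite memv_ker memv0 => /eqP c_ker.
  apply/eqP/matrixP => j k; rewrite (ord1 k) mxE.
  move: free_v => /(freeP (X := Tuple size_v))/(_ (c^~ 0)); apply; rewrite -[RHS]c_ker phiE.
  by apply: eq_bigr => i _; rewrite nthv.
have phi_im : limg phi = W.
  apply/eqP; rewrite eqEsubv; apply/andP; split.
    apply/subvP => _ /memv_imgP[c _ ->]; rewrite phiE memv_suml // => j _.
    by rewrite memvZ // mem_spin_chain_span.
  apply: span_mkseq_subv => i lt_im.
  by rewrite -(phi_delta (Ordinal lt_im)) memv_img ?memvf.
have phiK : cancel phi (phi^-1)%VF by apply/lker0_lfunK/eqP.
(* The action is pulled back along [phi]; the inverse makes sense because the image [W] is
   stable. *)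
pose actB a c := (phi^-1)%VF (act a (phi c)).
have phi_act a c : phi (actB a c) = act a (phi c).
  by rewrite limg_lfunVK // phi_im W_stable // -phi_im memv_img ?memvf.
(* The index [m+1] is included: there [vB] and the chain both vanish. *)
have phi_vB (i : nat) : (i <= m.+1)%N -> phi (vB K m i) = v i.
  rewrite leq_eqVlt => /orP[/eqP ->|lt_im].
    rewrite vS_eq0 phiE big1 // => j _; rewrite mxE.
    have -> : (j%:Z == m.+1%:Z) = false by have := ltn_ord j; lia.
    by rewrite scale0r.
  rewrite -(phi_delta (Ordinal lt_im)); congr (phi _); apply/matrixP => j k.
  by rewrite !mxE (ord1 k) andbT.
have phi_vBN : phi (vB K m (-1)) = 0.
  by rewrite phiE big1 // => j _; rewrite mxE scale0r.
exists actB; split; last by exists phi.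
split.
  split.
  - by move=> a k c c'; rewrite /actB !linearP linr linearP.
  - by move=> c k a b; rewrite /actB linl linearP.
  - by move=> c; rewrite /actB act1 phiK.
  - by move=> a b c; rewrite /actB phi_act actM.
have phiZ a c : phi (a *: c) = a *: phi c by rewrite linearZ.
have phiDZ a b c c' : phi (a *: c + b *: c') = a *: phi c + b *: phi c'.
  by rewrite linearP linearZZ.
have phi_inj : injective phi := can_inj phiK.
move=> i le_im; split; apply: phi_inj; rewrite phi_act phi_vB ?leqW ?phiDZ //.
- rewrite act_y !addn1 -[i%:Z + 1]/(Posz (i + 1)) !addn1 phi_vB //.
  case: i le_im => [|i] lt_im.
    by rewrite sub0r phi_vBN scaler0 add0r scale1r (spin_chainY0 YZu).
  rewrite (_ : i.+1%:Z - 1 = i%:Z) ?phi_vB //; try lia.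
  (* The natural number [m - (i+1) + 1] is [m - i] because [i < m]. *)
  rewrite (spin_chainYS XYZ Xu YZu); congr (_ *: _ + _).
  by rewrite -natrB ?(ltnW lt_im) // -subSn.
- by rewrite act_x phiZ phi_vB ?leqW // (spin_chainX XYZ Xu).
- rewrite spin_act_z -[i%:Z + 1]/(Posz (i + 1)) !addn1 phi_vB //.
  case: i le_im => [|i] lt_im.
    by rewrite sub0r phi_vBN scaler0 add0r mul1r scale1r (spin_chainZ0 YZu).
  rewrite (_ : i.+1%:Z - 1 = i%:Z) ?phi_vB //; try lia.
  rewrite (spin_chainZS XYZ Xu YZu) -exprnP; congr (_ * _ *: _ + _).
  by rewrite -natrB ?(ltnW lt_im) // -subSn.
Qed.

End TypeB.
End SpinMatrixModule.

(** * The dual adjacency matrix of the cube *)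

Section Cube.
Variables (C : numClosedFieldType) (D : nat).
Local Notation N := #|cube D|.
Local Notation A := (cube_adj C D).
Implicit Types (x y z : cube D) (S : {set 'I_D}).

Definition flip y (i : 'I_D) : cube D :=
  [ffun j => if j == i then ~~ y j else y j].

Lemma flip_inj y : injective (flip y).
Proof.
move=> i j /ffunP/(_ i); rewrite !ffunE eqxx.
by case: eqP => // _; case: (y i).
Qed.

Lemma cube_dist_flip y z :
  (cube_dist y z == 1%N) = (z \in [set flip y i | i in 'I_D]).
Proof.
apply/cards1P/imsetP => [[j yz]|[j _ ->]]; exists j => //.
  apply/ffunP => k; move/setP: yz => /(_ k); rewrite !inE ffunE.
  by case: (k == j); case: (y k); case: (z k).
by apply/setP => k; rewrite !inE ffunE; case: (k == j); case: (y k).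
Qed.

Lemma flipC y i j : flip (flip y i) j = flip (flip y j) i.
Proof. by apply/ffunP => k; rewrite !ffunE; do 2!case: eqP. Qed.

Lemma flipK y i : flip (flip y i) i = y.
Proof. by apply/ffunP => k; rewrite !ffunE; case: eqP => // _; rewrite negbK. Qed.

Lemma cube_adj_sum y (F : cube D -> C) :
  \sum_z (cube_dist y z == 1%N)%:R * F z = \sum_i F (flip y i).
Proof.
transitivity (\sum_(z in [set flip y i | i in 'I_D]) F z).
  rewrite [RHS]big_mkcond; apply: eq_bigr => z _; rewrite cube_dist_flip.
  by case: ifP; rewrite ?mul1r ?mul0r.
by rewrite big_imset // => i j _ _; apply: flip_inj.
Qed.

Lemma cube_adj_mulE p (M : 'M[C]_(N, p)) j k :
  (A *m M) j k = \sum_i M (enum_rank (flip (enum_val j) i)) k.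
Proof.
rewrite -(cube_adj_sum _ (fun z => M (enum_rank z) k)) mxE.
rewrite (reindex _ (onW_bij _ (@enum_rank_bij (cube D)))).
by apply: eq_bigr => z _; rewrite mxE enum_rankK.
Qed.

Lemma cube_distC y z : cube_dist y z = cube_dist z y.
Proof. by apply: eq_card => j; rewrite !inE eq_sym. Qed.

Lemma cube_adj_sym : A^T = A.
Proof. by apply/matrixP => j k; rewrite !mxE cube_distC. Qed.

(** * Coordinate signs and dual eigenvalues *)

Definition coord_sign y z (i : 'I_D) : C := (-1) ^+ (y i != z i).
(** The character of [(Z/2)^D] attached to [S], evaluated at [y + z]. *)
Definition cube_char S y z : C := \prod_(i in S) coord_sign y z i.
Definition parity_sign y z : C := \prod_i coord_sign y z i.
Definition coord_sum y z : C := \sum_i coord_sign y z i.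

Lemma coord_signC y z : coord_sign y z =1 coord_sign z y.
Proof. by move=> i; rewrite /coord_sign eq_sym. Qed.

Lemma coord_sign_flip y z i j :
  coord_sign (flip y i) z j = (-1) ^+ (j == i) * coord_sign y z j.
Proof.
rewrite /coord_sign ffunE; case: (j == i); last by rewrite mul1r.
by case: (y j); case: (z j); rewrite ?mulr1 ?mulN1r ?opprK.
Qed.

Lemma coord_sign_flipr y z i j :
  coord_sign y (flip z i) j = (-1) ^+ (j == i) * coord_sign y z j.
Proof. by rewrite coord_signC coord_sign_flip coord_signC. Qed.

Lemma coord_sign_sqr y z i : coord_sign y z i * coord_sign y z i = 1.
Proof. by rewrite -expr2 sqrr_sign. Qed.

Lemma coord_sign_real y z i : (coord_sign y z i)^* = coord_sign y z i.
Proof. by rewrite /coord_sign rmorph_sign. Qed.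

Lemma coord_sumE y z : coord_sum y z = D%:R - (2 * cube_dist y z)%N%:R.
Proof.
have signE (b : bool) : (-1) ^+ b = 1 - 2 * b%:R :> C.
  by case: b; rewrite ?mulr0 ?subr0 // mulr1 expr1; ring.
under [LHS]eq_bigr do rewrite /coord_sign signE.
rewrite sumrB sumr_const card_ord -mulr_sumr natrM; congr (_ - _ * _).
rewrite /cube_dist -sum1_card natr_sum [RHS]big_mkcond.
by apply: eq_bigr => i _; rewrite inE; case: (_ != _).
Qed.

Lemma parity_signE y z : parity_sign y z = (-1) ^+ cube_dist y z.
Proof.
rewrite /parity_sign /coord_sign /cube_dist prodrXr -sum1_card [in RHS]big_mkcond.
by congr (_ ^+ _); apply: eq_bigr => i _; rewrite inE; case: (_ != _).
Qed.

Lemma cube_thetaE y z :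
  cube_theta C D (cube_dist y z) = parity_sign y z * coord_sum y z.
Proof. by rewrite parity_signE coord_sumE. Qed.

Lemma coord_sum_flip y z i :
  coord_sum y (flip z i) = coord_sum y z - 2 * coord_sign y z i.
Proof.
rewrite /coord_sum (bigD1 i) //= [in RHS](bigD1 i) //= coord_sign_flipr eqxx.
rewrite (eq_bigr (coord_sign y z)); first by ring.
by move=> j /negPf neq_ji; rewrite coord_sign_flipr neq_ji mul1r.
Qed.

Lemma parity_sign_flip y z i : parity_sign y (flip z i) = - parity_sign y z.
Proof.
rewrite /parity_sign (bigD1 i) //= [in RHS](bigD1 i) //= coord_sign_flipr eqxx.
rewrite (eq_bigr (coord_sign y z)); first by ring.
by move=> j /negPf neq_ji; rewrite coord_sign_flipr neq_ji mul1r.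
Qed.

(** With [s] the parity sign and [a] the sum of the signs [a_j], [s a - s (a - 2 a_i) = 2 s a_i].
    This is twice a sign, so its square is the constant [4]. *)
Lemma cube_theta_flip x y i :
  cube_theta C D (cube_dist x y) + cube_theta C D (cube_dist x (flip y i)) =
  2 * parity_sign x y * coord_sign x y i.
Proof. by rewrite !cube_thetaE parity_sign_flip coord_sum_flip; ring. Qed.

(** [coord_sum] is [D] minus twice the distance, and a flip changes it by [2] or [-2]. *)
Lemma cube_dist_step x y z : cube_dist y z = 1%N ->
  cube_dist x z = (cube_dist x y).+1 \/ cube_dist x y = (cube_dist x z).+1.
Proof.
move/eqP; rewrite cube_dist_flip => /imsetP[i _ ->].
have := coord_sum_flip x y i; rewrite !coord_sumE !natrM /coord_sign.
set d := cube_dist x y; set d' := cube_dist x _.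
have nat_eq (a b : nat) : a%:R = b%:R :> C -> a = b.
  by move/eqP; rewrite eqr_nat => /eqP.
case: (x i != y i); rewrite ?expr1 ?expr0 => /eqP;
  rewrite -subr_eq0 => /eqP e; [right|left]; apply: nat_eq;
  apply: (@mulfI C 2); rewrite ?pnatr_eq0 // -natr1.
- by rewrite -[LHS]subr0 -[X in _ - X]e; ring.
- by rewrite -[LHS]addr0 -[X in _ + X]e; ring.
Qed.

(** * Characters and primitive idempotents *)

(** The rank one projection onto the line spanned by the character of [S]. *)
Definition char_idempotent S : 'M[C]_N :=
  \matrix_(j, k) (N%:R^-1 * cube_char S (enum_val j) (enum_val k)).

Lemma cube_char_flip S y z i :
  cube_char S (flip y i) z = (-1) ^+ (i \in S) * cube_char S y z.
Proof.
rewrite /cube_char (eq_bigr _ (fun j _ => coord_sign_flip y z i j)) big_split /=.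
congr (_ * _); have [Si|S'i] := boolP (i \in S).
  rewrite (bigD1 i) //= eqxx big1 ?mulr1 // => j /andP[_ /negPf ->].
  by rewrite expr0.
by apply: big1 => j Sj; case: eqP => // eq_ji; rewrite -eq_ji Sj in S'i.
Qed.

Lemma char_idempotent_adj S :
  A *m char_idempotent S = (D%:R - (2 * #|S|)%N%:R) *: char_idempotent S.
Proof.
apply/matrixP => j k; rewrite cube_adj_mulE !mxE.
under eq_bigr do rewrite mxE enum_rankK cube_char_flip mulrCA.
rewrite -mulr_suml; congr (_ * _).
have signE (b : bool) : (-1) ^+ b = 1 - 2 * b%:R :> C.
  by case: b; rewrite ?mulr0 ?subr0 // mulr1 expr1; ring.
under eq_bigr do rewrite signE.
rewrite sumrB sumr_const card_ord -mulr_sumr natrM; congr (_ - _ * _).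
rewrite -sum1_card natr_sum [RHS]big_mkcond.
by apply: eq_bigr => i _; case: (_ \in _).
Qed.

Lemma char_idempotent_sym S : (char_idempotent S)^T = char_idempotent S.
Proof.
apply/matrixP => j k; rewrite !mxE; congr (_ * _).
by apply: eq_bigr => i _; rewrite coord_signC.
Qed.

Lemma card_cube : N = (2 ^ D)%N.
Proof. by rewrite card_ffun card_bool card_ord. Qed.

Lemma cube_card_neq0 : N%:R != 0 :> C.
Proof. by rewrite pnatr_eq0 card_cube expn_eq0. Qed.

(** The sum of all characters at [y + z] factors as [prod_i (a_i + 1)], which vanishes as soon as
    [y] and [z] differ somewhere. *)
Lemma char_idempotent_sum : \sum_S char_idempotent S = 1%:M.
Proof.
apply/matrixP => j k; rewrite summxE !mxE.
under eq_bigr do rewrite mxE.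
rewrite -mulr_sumr; set y := enum_val j; set z := enum_val k.
have -> : \sum_S cube_char S y z = \prod_i (coord_sign y z i + 1).
  rewrite bigA_distr; apply: eq_bigr => S _.
  by rewrite /cube_char big_mkcond.
have [eq_jk|neq_jk] := eqVneq j k.
  rewrite (eq_bigr (fun=> 2)) => [|i _]; last first.
    by rewrite /coord_sign /y /z eq_jk eqxx expr0.
  by rewrite prodr_const card_ord -natrX -card_cube mulVf ?cube_card_neq0.
have [i neq_i] : exists i, y i != z i.
  apply/existsP; apply: contraNT neq_jk; rewrite negb_exists => /forallP eq_yz.
  apply/eqP/enum_val_inj/ffunP => i.
  by have := eq_yz i; rewrite negbK => /eqP.
by rewrite (bigD1 i) //= /coord_sign neq_i addNr mul0r mulr0.
Qed.

(** [F] is idempotent and Hermitian, so the rows of [1 - F] are orthogonal to [U]; the projection is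
    computed on both parts of [1 = (1 - F) + F]. *)
Lemma eq_proj_ortho n p (U : 'M[C]_(p, n)) (F : 'M[C]_n) :
  (F <= U)%MS -> U *m F = U -> map_mx Num.conj F^T = F -> proj_ortho U = F.
Proof.
move=> FU UF F_herm.
have FF : F *m F = F by have [M def_F] := submxP FU; rewrite {1}def_F -mulmxA UF -def_F.
rewrite -[proj_ortho U]mul1mx -(subrK F 1%:M) mulmxDl (proj_ortho_id FU).
rewrite proj_ortho_0 ?add0r //; apply/orthomx1P.
by rewrite -UF trmx_mul map_mxM F_herm mulmxA mulmxBl mul1mx FF subrr mul0mx.
Qed.

Lemma primitive_idempotentE (i : nat) : (i <= D)%N ->
  primitive_idempotent A (D%:R - (2 * i)%N%:R) =
  \sum_(S : {set 'I_D} | #|S| == i) char_idempotent S.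
Proof.
move=> le_iD; set lambda := D%:R - _; set F := \sum_(S | _) _.
have F_sym : F^T = F.
  by rewrite raddf_sum; apply: eq_bigr => S _; apply: char_idempotent_sym.
have char_adj S : char_idempotent S *m A =
    (D%:R - (2 * #|S|)%N%:R) *: char_idempotent S.
  by rewrite -[LHS]trmxK trmx_mul char_idempotent_sym cube_adj_sym
    char_idempotent_adj linearZ /= char_idempotent_sym.
rewrite /primitive_idempotent cube_adj_sym (@eq_proj_ortho _ _ _ F) //.
- apply/eigenspaceP; rewrite mulmx_suml scaler_sumr.
  by apply: eq_bigr => S /eqP card_S; rewrite char_adj card_S.
- set U := eigenspace A lambda.
  have UA : U *m A = lambda *: U by apply/eigenspaceP.
  (* Insert [1 = sum_S E_S]. For [#|S| != i], computing [U A E_S] in two ways gives [U E_S = 0]. *)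
  rewrite -[RHS]mulmx1 -char_idempotent_sum (bigID (fun S => #|S| == i)) /=.
  rewrite mulmxDr [X in _ = _ + X]mulmx_sumr [X in _ = _ + X]big1 ?addr0 //.
  move=> S neq_Si; apply/eqP; have := congr1 (mulmx^~ (char_idempotent S)) UA.
  rewrite /= -mulmxA char_idempotent_adj -scalemxAr -scalemxAl => /eqP.
  rewrite -subr_eq0 -scalerBl scaler_eq0 => /orP[|//].
  rewrite /lambda !natrM [X in X == 0](_ : _ = 2 * (i%:R - #|S|%:R)); last by ring.
  by rewrite mulf_eq0 pnatr_eq0 /= subr_eq0 eqr_nat eq_sym (negPf neq_Si).
- rewrite F_sym; apply/matrixP => j k; rewrite mxE summxE rmorph_sum.
  apply: eq_bigr => S _; rewrite mxE rmorphM fmorphV rmorph_nat rmorph_prod.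
  by congr (_ * _); apply: eq_bigr => l _; rewrite /= coord_sign_real.
Qed.

Lemma dual_adjE x : (0 < D)%N ->
  dual_adj C x =
  diag_mx (\row_j cube_theta C D (cube_dist x (enum_val j))).
Proof.
move=> D_gt0; rewrite /dual_adj.
(* The eigenvalue belongs to the sets of size [D - 1], the complements of single coordinates. *)
have -> : cube_theta C D 1 = D%:R - (2 * D.-1)%N%:R.
  by rewrite /cube_theta expr1 muln1 natrM -subn1 natrB //; ring.
rewrite primitive_idempotentE ?leq_pred //; congr diag_mx.
apply/matrixP => k j; rewrite !mxE summxE.
under eq_bigr do rewrite mxE enum_rankK.
rewrite -mulr_sumr mulrA mulfV ?cube_card_neq0 // mul1r cube_thetaE.
set y := enum_val j.
rewrite (reindex_inj (@setC_inj _)) /=.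
rewrite (eq_bigl (fun S : {set 'I_D} => #|S| == 1%N)); last first.
  move=> S; have := cardsC S; rewrite card_ord; move: #|S| #|~: S| => a b.
  by move=> def_D; apply/eqP/eqP; lia.
rewrite big_cards1 /coord_sum mulr_sumr; apply: eq_bigr => i _.
(* As [a_i^2 = 1], the product of all signs but [a_i] is [s a_i]. *)
rewrite /parity_sign (bigD1 i) //= mulrAC coord_sign_sqr mul1r.
by apply: eq_bigl => l; rewrite !inE.
Qed.

(** * Irreducible modules of the Terwilliger algebra *)

Local Notation V := (std_module C D).

Section Terwilliger.
Variable x : cube D.
Hypotheses (D_gt0 : (0 < D)%N) (D_even : ~~ odd D).
Local Notation B := (dual_adj C x).
Local Notation theta := (cube_theta C D).
Local Notation layer j := (cube_dist x (enum_val j)).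

Lemma mul_dual_adj p (M : 'M[C]_(N, p)) j k :
  (B *m M) j k = theta (layer j) * M j k.
Proof. by rewrite dual_adjE // mul_diag_mx !mxE. Qed.

Lemma mulmx_dual_adj p (M : 'M[C]_(p, N)) j k :
  (M *m B) j k = theta (layer k) * M j k.
Proof. by rewrite dual_adjE // mul_mx_diag !mxE mulrC. Qed.

Lemma mul_dual_idempotent i p (M : 'M[C]_(N, p)) j k :
  (dual_idempotent C x i *m M) j k = (layer j == i)%:R * M j k.
Proof. by rewrite mul_diag_mx !mxE. Qed.

(* Summing the second difference of theta over the walks y, y + i, y + i + j:
   the terms with i <> j cancel in pairs since they are antisymmetric. *)
Lemma cube_spin_sum (G : cube D -> C) y :
  \sum_i \sum_j (theta (cube_dist x y) + 2 * theta (cube_dist x (flip y i))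
                + theta (cube_dist x (flip (flip y i) j)))
               * G (flip (flip y i) j) =
  4 * theta (cube_dist x y) * G y.
Proof.
set s := parity_sign x y; pose a i := coord_sign x y i.
pose g i j := G (flip (flip y i) j).
(* The second difference is the sum of the first differences [2 s a_i] and [-2 s a_j], the latter
   with opposite sign if [i = j]; the second double sum collects that correction. *)
transitivity (2 * s * (\sum_i \sum_j (a i - a j) * g i j
   + \sum_i \sum_j (1 - (-1) ^+ (j == i)) * a j * g i j)).
  rewrite -big_split mulr_sumr; apply: eq_bigr => i _.
  rewrite -big_split mulr_sumr; apply: eq_bigr => j _ /=.
  have h1 := cube_theta_flip x y i; have h2 := cube_theta_flip x (flip y i) j.
  rewrite parity_sign_flip coord_sign_flipr in h2.
  have regroup (p q r : C) : p + 2 * q + r = (p + q) + (q + r) by ring.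
  rewrite regroup h1 h2 -/s -/(a i) -/(a j) -/(g i j).
  by ring.
rewrite [X in X + _](_ : _ = 0) ?add0r; last first.
  have skew : \sum_i \sum_j (a i - a j) * g i j =
      - (\sum_i \sum_j (a i - a j) * g i j).
    rewrite {1}exchange_big -sumrN; apply: eq_bigr => i _.
    rewrite -sumrN; apply: eq_bigr => j _.
    by rewrite /g flipC -mulNr opprB.
  by move/eqP: skew; rewrite -addr_eq0 -mulr2n mulrn_eq0 => /eqP.
rewrite cube_thetaE -/s /coord_sum.
transitivity (2 * s * \sum_i 2 * a i * G y).
  congr (_ * _); apply: eq_bigr => i _; rewrite (bigD1 i) //= big1 ?addr0.
    by rewrite eqxx /g flipK expr1 opprK.
  by move=> j /negPf ->; rewrite expr0 subrr !mul0r.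
by rewrite -mulr_suml -mulr_sumr; ring.
Qed.

Definition cube_spin_z : 'M[C]_N := 2^-1 *: (A *m B + B *m A).

Lemma cube_spin_triple : spin_triple A B cube_spin_z.
Proof.
split.
- by rewrite scalerA mulfV ?pnatr_eq0 // scale1r.
(* On an edge, the left side has entry [(theta_j + theta_k)^2 / 2 = 2]; elsewhere both sides
   vanish. *)
- apply/matrixP => j k; rewrite [in LHS]mxE mul_dual_adj mulmx_dual_adj.
  rewrite mxE [in RHS]mxE [(A *m B + _) j k]mxE mul_dual_adj mulmx_dual_adj mxE.
  rewrite cube_dist_flip; case: imsetP => [[i _ ->]|_]; last by rewrite !(mulr0, addr0).
  have s2 : parity_sign x (enum_val j) * parity_sign x (enum_val j) = 1.
    by rewrite parity_signE -expr2 sqrr_sign.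
  have a2 := coord_sign_sqr x (enum_val j) i.
  have h := cube_theta_flip x (enum_val j) i.
  rewrite !mulr1 [X in 2^-1 * X]addrC -mulrDl h.
  move: s2 a2; move: (parity_sign _ _) (coord_sign _ _ _) => s a s2 a2.
  apply: (@mulfI C 2); rewrite ?pnatr_eq0 //.
  transitivity (4 * (s * s) * (a * a)); first by field.
  by rewrite s2 a2; ring.
(* The third relation with [z] expanded and denominators cleared. The factors [1%:M] give every
   product the form [A *m M] or [B *m M], so entries become sums over walks of length two. *)
- have expand : B *m (A *m (A *m 1%:M)) + 2 *: (A *m (B *m (A *m 1%:M)))
      + A *m (A *m (B *m 1%:M)) = 4 *: (B *m 1%:M).
    apply/matrixP => j k.
    have entry (P Q R : 'M[C]_N) : (P + 2 *: Q + R) j k = P j k + 2 * Q j k + R j k.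
      by rewrite !mxE.
    rewrite entry [RHS]mxE !mul_dual_adj mulrA.
    pose G z := (1%:M : 'M[C]_N) (enum_rank z) k.
    have := cube_spin_sum G (enum_val j).
    rewrite {2}/G enum_valK => <-; rewrite !cube_adj_mulE !mulr_sumr -!big_split.
    apply: eq_bigr => i _ /=.
    rewrite mul_dual_adj !cube_adj_mulE !mulr_sumr -!big_split.
    apply: eq_bigr => l _ /=.
    by rewrite mul_dual_adj !enum_rankK -/(G _); ring.
  rewrite /cube_spin_z -scalemxAl -scalemxAr -scalerDr.
  apply: (@scalerI _ _ 2); rewrite ?pnatr_eq0 // !scalerA mulfV ?pnatr_eq0 //.
  rewrite scale1r -natrM -[B in RHS]mulmx1 -expand !mulmx1 mulmxDl mulmxDr.
  rewrite -!mulmxA; move: (A *m (B *m A)) (B *m (A *m A)) (A *m (A *m B)) => P Q R.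
  by apply/matrixP => j k; rewrite !mxE; ring.
Qed.

(** * Invariance under T and under the two adjacency matrices *)

(** Evenness matters: for odd [D] the values at [i] and [D - i] coincide. *)
Lemma cube_theta_inj : injective theta.
Proof.
have inj := @spin_eigenvalue_inj C D./2; move=> i j; rewrite /cube_theta => e.
apply: inj; rewrite -[(2 * _)%R]/(Posz (2 * D./2)) mul2n.
by have := odd_double_half D; rewrite (negPf D_even) add0n => ->.
Qed.

Lemma terwilliger_stable_adj (W : {vspace V}) :
  stable (terwilliger_act (x := x)) W ->
  (forall w, w \in W -> A *m w \in W) /\ (forall w, w \in W -> B *m w \in W).
Proof.
move=> W_stable; split=> w Ww.
  exact: (W_stable (exist _ _ (terwilliger_adj C x)) w Ww).
(* The spectral decomposition of [B] along the layers. *)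
have -> : B *m w = \sum_(i < D.+1) theta i *: (dual_idempotent C x i *m w).
  apply/matrixP => j k; rewrite mul_dual_adj summxE.
  have lt_jD : (layer j < D.+1)%N by rewrite ltnS -[D in (_ <= D)%N]card_ord max_card.
  rewrite (bigD1 (Ordinal lt_jD)) //= mxE mul_dual_idempotent eqxx mul1r.
  rewrite big1 ?addr0 // => i neq_ij; rewrite mxE mul_dual_idempotent.
  by rewrite eq_sym (negPf (neq_ij : (i : nat) != layer j)) mul0r mulr0.
apply: memv_suml => i _; apply: memvZ.
exact: (W_stable (exist _ _ (terwilliger_dual C x (ltnSE (ltn_ord i)))) w Ww).
Qed.

(* As D is even, B has distinct eigenvalues on the layers, so the dual
   idempotents are Lagrange polynomials in B. *)
Lemma adj_stable_terwilliger (W : {vspace V}) :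
  (forall w, w \in W -> A *m w \in W) -> (forall w, w \in W -> B *m w \in W) ->
  stable (terwilliger_act (x := x)) W.
Proof.
move=> WA WB [M TM] w; rewrite /terwilliger_act /=.
elim: TM w => {M} [|i le_iD|a|M M' _ IHM _ IHM'|M M' _ IHM _ IHM'] w Ww.
- exact: WA.
(* [q s d] is the value at [theta d] of the polynomial with roots [theta k], [k] in [s]. Each factor
   acts as [B - theta k] and preserves [W]; with all layers but [i] in [s], a multiple of [E*_i w]
   remains. *)
- pose q (s : seq nat) (d : nat) := \prod_(k <- s) (theta d - theta k).
  have Wq s : \col_j (q s (layer j) * w j 0) \in W.
    elim: s => [|k s IHs].
      rewrite (_ : \col_j _ = w) //; apply/matrixP => j l.
      by rewrite mxE /q big_nil mul1r (ord1 l).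
    set w' := \col_j _ in IHs.
    rewrite (_ : \col_j _ = B *m w' - theta k *: w') ?memvB ?memvZ ?WB //.
    apply/matrixP => j l; rewrite mxE [RHS]mxE mul_dual_adj !mxE /q big_cons.
    by rewrite -mulrA mulrBl.
  pose s := [seq k <- iota 0 D.+1 | k != i].
  have qi_neq0 : q s i != 0.
    rewrite /q prodf_seq_neq0; apply/allP => k; rewrite mem_filter => /andP[neq_ki _].
    by rewrite /= subr_eq0 (inj_eq cube_theta_inj) eq_sym.
  rewrite (_ : _ *m w = (q s i)^-1 *: \col_j (q s (layer j) * w j 0)) ?memvZ //.
  apply/matrixP => j l; rewrite mul_dual_idempotent !mxE (ord1 l) mulrA.
  case: eqP => [->|/eqP neq_ji]; first by rewrite mulVf.
  have -> : q s (layer j) = 0; last by rewrite mulr0 !mul0r.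
  apply/eqP; rewrite prodf_seq_eq0; apply/hasP.
  exists (layer j); last by rewrite /= subrr.
  by rewrite mem_filter neq_ji mem_iota /= ltnS -[D in (_ <= D)%N]card_ord max_card.
- by rewrite mul_scalar_mx memvZ.
- by rewrite mulmxDl memvD ?IHM ?IHM'.
- by rewrite -mulmxA IHM ?IHM'.
Qed.

(** * The two chains of an irreducible module *)

Section IrreducibleModule.
Variables (W : {vspace V}) (r : nat).
Hypothesis W_irr : irreducible (terwilliger_act (x := x)) W.
Hypothesis W_end : endpoint x W r.

Let WA w : w \in W -> A *m w \in W.
Proof. by case: W_irr => /terwilliger_stable_adj[+ _] _ _; apply. Qed.

Let WB w : w \in W -> B *m w \in W.
Proof. by case: W_irr => /terwilliger_stable_adj[_ +] _ _; apply. Qed.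

Lemma irreducible_eq (U : {vspace V}) w : (U <= W)%VS -> w \in U -> w != 0 ->
  (forall v, v \in U -> A *m v \in U) -> (forall v, v \in U -> B *m v \in U) ->
  U = W.
Proof.
move=> sUW Uw w_neq0 UA UB; case: W_irr => _ _ irr.
case: (irr U (adj_stable_terwilliger UA UB) sUW) => // U_eq0.
by rewrite U_eq0 memv0 (negPf w_neq0) in Uw.
Qed.

(** For [w] in [E*_r W], [A w] lives on layers [r-1] and [r+1], and the lower part is zero as [r] is
    the endpoint. So [B] acts on [A w] by [theta (r+1)], and [theta r + theta (r+1) = 2 (-1)^r]. *)
Lemma endpoint_vector : exists w, [/\ w \in W, w != 0, B *m w = theta r *: w
  & A *m w = (-1) ^+ r *: (cube_spin_z *m w)].
Proof.
case: W_end => _ Er_neq0 E_eq0.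
have /memv_imgP[w0 Ww0] := memv_pick
  (linfun (mulmx (dual_idempotent C x r) : V -> V) @: W)%VS.
rewrite lfunE /= => def_w; set w := _ *m w0 in def_w.
have w_neq0 : w != 0 by rewrite -def_w vpick0.
have Ww : w \in W.
  case: W_end => le_rD _ _; case: W_irr => W_stable _ _.
  exact: (W_stable (exist _ _ (terwilliger_dual C x le_rD)) w0 Ww0).
have supp_w j k : w j k != 0 -> layer j = r.
  rewrite /w mul_dual_idempotent; case: (layer j =P r) => // _.
  by rewrite mul0r eqxx.
clearbody w; have supp_Aw j k : (A *m w) j k != 0 -> layer j = r.+1.
  have [lt_jr|le_rj] := ltnP (layer j) r.
    have := memv_img (linfun (mulmx (dual_idempotent C x (layer j)) : V -> V)) (WA Ww).
    rewrite E_eq0 // memv0 lfunE /= => /eqP/matrixP/(_ j k).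
    by rewrite mul_dual_idempotent eqxx mul1r [RHS]mxE => ->; rewrite eqxx.
  apply: contraNeq => neq_jr; rewrite mxE big1 // => l _; rewrite mxE.
  case: eqP => [dist_jl|_]; last by rewrite mul0r.
  apply/eqP; rewrite mul1r; apply: contraNT neq_jr => /supp_w lay_l.
  have := cube_dist_step x dist_jl; rewrite lay_l => -[lay_j|->//].
  by rewrite lay_j ltnn in le_rj.
have Bw : B *m w = theta r *: w.
  apply/matrixP => j k; rewrite mul_dual_adj mxE.
  by have [->|/supp_w ->] := eqVneq (w j k) 0; rewrite ?mulr0.
exists w; split=> //.
apply/matrixP => j k; rewrite [RHS]mxE -scalemxAl [in RHS]mxE.
have -> : ((A *m B + B *m A) *m w) j k = (theta r + theta (layer j)) * (A *m w) j k.
  by rewrite mulmxDl -!mulmxA Bw -scalemxAr [LHS]mxE [X in X + _]mxE mul_dual_adj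
    mulrDl.
have [->|/supp_Aw ->] := eqVneq ((A *m w) j k) 0; first by rewrite !mulr0.
have -> : theta r + theta r.+1 = 2 * (-1) ^+ r.
  by rewrite /cube_theta exprS !natrM -natr1; ring.
have := sqrr_sign C r; move: ((A *m w) j k) ((-1) ^+ r) => q e ee.
by rewrite -[LHS]mul1r -[X in X * _ = _]ee; field.
Qed.

(** The first chain diagonalizes [B] whereas the model has [A] diagonal; its sum starts the second
    chain, with the required roles. *)
Lemma terwilliger_irreducible_chain : exists u,
  [/\ (2 * r <= D)%N, A *m u = (D - 2 * r)%N%:R *: u, B *m u = cube_spin_z *m u,
      free (mkseq (spin_chain B cube_spin_z u) (D - 2 * r).+1)
    & spin_chain B cube_spin_z u (D - 2 * r).+1 = 0 /\
      <<mkseq (spin_chain B cube_spin_z u) (D - 2 * r).+1>>%VS = W].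
Proof.
have [w [Ww w_neq0 Bw Aw]] := endpoint_vector.
have triple := cube_spin_triple.
have ee : (-1) ^+ r * (-1) ^+ r = 1 :> C by rewrite -expr2 sqrr_sign.
have WZ e v : v \in W -> (e *: cube_spin_z) *m v \in W.
  move=> Wv; rewrite -scalemxAl memvZ // -scalemxAl memvZ // mulmxDl -!mulmxA.
  by rewrite memvD ?WA ?WB // ?WA ?WB.
have triple' := spin_triple_twist ee triple.
pose delta : C := D%:R - (2 * r)%N%:R.
have def_delta : delta = (2 * (D./2%:Z - r%:Z))%:~R.
  rewrite /delta mulrBr intrB -[(2 * D./2%:Z)%R]/(Posz (2 * D./2)) [(2 * D./2)%N]mul2n.
  by have := odd_double_half D; rewrite (negPf D_even) add0n => ->.
have Xw : ((-1) ^+ r *: B) *m w = delta *: w.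
  by rewrite -scalemxAl Bw scalerA /cube_theta mulrA ee mul1r.
have YZw : A *m w = ((-1) ^+ r *: cube_spin_z) *m w by rewrite -scalemxAl.
have [m [delta_m free_v vS_eq0]] := spin_chain_end triple' Xw YZw def_delta w_neq0.
set v := spin_chain _ _ _ in free_v vS_eq0.
(* Since [delta = D - 2r] equals the natural number [m], [2r <= D] follows. *)
have [le_rD def_m] : (2 * r <= D)%N /\ (D - 2 * r)%N = m.
  have : (D == m + 2 * r)%N by rewrite -(eqr_nat C) natrD -delta_m /delta subrK.
  by move/eqP=> defD; split; lia.
rewrite def_m.
have Wv i : v i \in W by apply: mem_spin_chain => // b; apply: WZ.
pose u := \sum_(i < m.+1) v i.
have u_neq0 : u != 0 := spin_chain_sum_neq0 free_v.
have Wu : u \in W by apply: memv_suml.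
have defW : <<mkseq v m.+1>>%VS = W.
  have [stabX stabY] := spin_chain_span_stable triple' Xw YZw vS_eq0.
  apply: (irreducible_eq (w := w)) => //.
  - by apply: span_mkseq_subv => i _.
  - exact: (mem_spin_chain_span _ _ _ (ltn0Sn m)).
  (* Stability holds for [(-1)^r B]; the sign is removed by scaling. *)
  - move=> b /stabX; rewrite -scalemxAl => /(memvZ ((-1) ^+ r)).
    by rewrite scalerA ee scale1r.
have Au : A *m u = m%:R *: u.
  rewrite mulmx_sumr (spin_chain_sumY triple' Xw YZw) -/v vS_eq0 delta_m.
  by rewrite subrr scale0r scaler0 addr0 subr0.
have Bu : B *m u = cube_spin_z *m u.
  have := spin_chain_sumZ triple' Xw YZw m.
  rewrite -/v vS_eq0 delta_m subrr scale0r scaler0 subr0 scaler0 addr0.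
  rewrite -!mulmx_sumr -!(scalemxAl (_ ^+ _)) => /(congr1 ( *:%R ((-1) ^+ r))).
  by rewrite !scalerA ee !scale1r => ->.
rewrite delta_m in def_delta.
(* The second chain has the same [delta], so it ends at the same index. *)
have [m' [/eqP]] := spin_chain_end triple Au Bu def_delta u_neq0.
rewrite eqr_nat => /eqP <- free_u uS_eq0; exists u; split=> //; split=> //.
have [stabA stabB] := spin_chain_span_stable triple Au Bu uS_eq0.
apply: (irreducible_eq (w := u)) => //.
- apply: span_mkseq_subv => i _; apply: mem_spin_chain => // b.
  by rewrite -[cube_spin_z]scale1r; apply: WZ.
- exact: (mem_spin_chain_span _ _ _ (ltn0Sn m)).
Qed.

End IrreducibleModule.
End Terwilliger.
End Cube.

Theorem theorem11p6 (R : realType) (D : nat) (x : cube D)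
    (hD0 : (0 < D)%N) (hDeven : ~~ odd D) :
  (exists! act : spin_algebra R[i] -> std_module R[i] D -> std_module R[i] D,
     cube_spin_module x act)
  /\
  (forall act : spin_algebra R[i] -> std_module R[i] D -> std_module R[i] D,
     cube_spin_module x act ->
     forall (W : {vspace std_module R[i] D}) (r : nat),
       irreducible (terwilliger_act (x := x)) W -> endpoint x W r ->
       [/\ irreducible act W, (2 * r <= D)%N & typeB act W (D - 2 * r)]).
Proof.
have triple := @cube_spin_triple R[i] D x hD0.
split.
  have act_module := spin_mx_act_module triple.
  exists (spin_mx_act (cube_adj R[i] D) (dual_adj R[i] x) (cube_spin_z R[i] x)); split.
    by split=> // v; rewrite (spin_mx_act_pi triple).
  move=> act [act_mod act_x act_y]; apply/funext => a; apply/funext => v.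
  elim/spin_piW: a => a.
  by rewrite (spin_mx_act_pi triple) (spin_act_mxE triple act_mod act_x act_y).
move=> act [act_mod act_x act_y] W r W_irr W_end.
have [u [le_rD Au Bu free_u [uS_eq0 defW]]] :=
  terwilliger_irreducible_chain hD0 hDeven W_irr W_end.
split=> //; last first.
  rewrite -defW; apply: (spin_chain_typeB triple) => //.
  by rewrite oddB // oddM addbF.
(* A subspace stable under [act] is stable under [A] and [B], hence under T, so irreducibility
   carries over. *)
case: W_irr => W_stable W_neq0 irr; split=> // [|U U_stable sUW].
  have [WA WB] := terwilliger_stable_adj hD0 W_stable.
  exact: (spin_act_stable triple act_mod act_x act_y).
apply: irr sUW; apply: adj_stable_terwilliger => // w Uw.
  by rewrite -act_x; apply: U_stable.
by rewrite -act_y; apply: U_stable.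
Qed.
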